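(* Let $d \in \mathbb{N} \cup \{\infty\}$ and let $\mathcal{F}$ be an $f$-triangle of size $d$. There exist nonnegative integers $p_{\mathcal{F}}(n,k,j)$, for $n \in \{0,1,\dots,d\}$ and $k, j \in \{0,1,\dots,n\}$, such that for all $n \le d$, $$h_j(\Delta') \ = \ \sum_{k=0}^n p_{\mathcal{F}}(n,k,j)\, h_k(\Delta)$$ for every $(n-1)$-dimensional simplicial complex $\Delta$, every $\mathcal{F}$-uniform triangulation $\Delta'$ of $\Delta$ and all $j \in \{0,1,\dots,n\}$.
   Context: Conventions: $\mathbb{N} = \{0,1,2,\dots\}$; $\{0,1,\dots,d\} := \mathbb{N}$ when $d=\infty$; $n,k,j$ are always finite. All simplicial complexes are finite abstract simplicial complexes (containing the empty face, of dimension $-1$). For an $(n-1)$-dimensional simplicial complex $\Delta$, let $f_{i}(\Delta)$ be the number of $i$-dimensional faces, $f(\Delta,x) = \sum_{i=0}^n f_{i-1}(\Delta)x^i$, and $h(\Delta,x) = (1-x)^n f(\Delta, \frac{x}{1-x}) = \sum_{i=0}^n f_{i-1}(\Delta)x^i(1-x)^{n-i} =: \sum_{i=0}^n h_i(\Delta)x^i$. A simplicial complex $\Delta'$ is a triangulation of $\Delta$ if there are geometric realizations $K'$ and $K$ of $\Delta'$ and $\Delta$ such that $K'$ geometrically subdivides $K$. For a face $F \in \Delta$, the restriction $\Delta'_F$ is the subcomplex of $\Delta'$ corresponding to the triangulation which $K'$ induces on the simplex of $K$ corresponding to $F$. An $f$-triangle of size $d$ is a triangular array $\mathcal{F} = (f_{\mathcal{F}}(i,j))_{0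 \le i \le j \le d}$ of nonnegative integers ($i,j$ finite). Given a simplicial complex $\Delta$ of dimension less than $d$, a triangulation $\Delta'$ of $\Delta$ is $\mathcal{F}$-uniform if for all $0 \le i \le j \le d$, the restriction of $\Delta'$ to any $(j-1)$-dimensional face of $\Delta$ has exactly $f_{\mathcal{F}}(i,j)$ faces of dimension $i-1$. *)

(* Defs.v *)
From mathcomp Require Import all_boot all_algebra.
From mathcomp Require Import boolp classical_sets reals.

Set Implicit Arguments.
Unset Strict Implicit.
Unset Printing Implicit Defensive.

Import GRing.Theory Num.Theory.

Local Open Scope ring_scope.

(* The finite type V may contain elements that are not vertices, i.e. elements
   v such that [set v] is not a face. *)
Record simplicial_complex (V : finType) := SimplicialComplex {
  faces :> {set {set V}};
  face_empty : finset.set0 \in faces;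
  face_closed : forall F G : {set V},
    F \in faces -> G \subset F -> G \in faces
}.

(* A face F has dimension #|F| - 1. To avoid the value -1, faces are counted by
   cardinality, and [rank D] is dim D + 1. *)
Definition fnum (V : finType) (D : {set {set V}}) (i : nat) : nat :=
  #|[set F : {set V} in D | #|F| == i]|.

Definition rank (V : finType) (D : {set {set V}}) : nat :=
  (\max_(F in D) #|F|)%N.

Definition hpoly (V : finType) (D : {set {set V}}) : {poly int} :=
  \sum_(i < (rank D).+1)
    (fnum D i)%:R *: ('X^i * (1 - 'X) ^+ (rank D - i)).

Definition hnum (V : finType) (D : {set {set V}}) (j : nat) : int :=
  (hpoly D)`_j.

Section Geometry.

Variables (R : realType) (N : nat).

Definition aff_indep (V : finType) (phi : V -> 'rV[R]_N) (F : {set V}) : Prop :=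
  forall c : V -> R,
    \sum_(v in F) c v = 0 -> \sum_(v in F) c v *: phi v = 0 ->
    forall v, v \in F -> c v = 0.

(* The convex hull of phi(F). It is empty when F is empty. *)
Definition simplex (V : finType) (phi : V -> 'rV[R]_N) (F : {set V}) :
    set 'rV[R]_N :=
  [set x | exists c : V -> R,
     [/\ forall v, v \in F -> 0 <= c v,
         \sum_(v in F) c v = 1 &
         x = \sum_(v in F) c v *: phi v]]%classic.

(* The simplices spanned by the images of the faces of D form a geometric
   simplicial complex with face poset D. The second condition with disjoint F
   and G makes phi injective on the vertices of D; the values of phi at
   non-vertices are irrelevant. *)
Definition realization (V : finType) (D : {set {set V}})
    (phi : V -> 'rV[R]_N) : Prop :=
  (forall F : {set V}, F \in D -> aff_indep phi F) /\
  (forall F G : {set V}, F \in D -> G \in D ->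
     (simplex phi F `&` simplex phi G)%classic = simplex phi (F :&: G)).

Definition polyhedron (V : finType) (D : {set {set V}})
    (phi : V -> 'rV[R]_N) : set 'rV[R]_N :=
  [set x | exists2 F : {set V}, F \in D & simplex phi F x]%classic.

Definition subdivides (V V' : finType) (D : {set {set V}})
    (D' : {set {set V'}}) (phi : V -> 'rV[R]_N) (phi' : V' -> 'rV[R]_N) :
    Prop :=
  (forall G : {set V'}, G \in D' ->
     exists2 F : {set V}, F \in D &
       (simplex phi' G `<=` simplex phi F)%classic) /\
  polyhedron D' phi' = polyhedron D phi.

End Geometry.

(* The realizations are part of the data because the restriction of D' to a
   face of D depends on them. *)
Record triangulation (R : realType) (V V' : finType)
    (D : simplicial_complex V) (D' : simplicial_complex V') := Triangulation {
  tri_dim : nat;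
  tri_base : V -> 'rV[R]_tri_dim;
  tri_fine : V' -> 'rV[R]_tri_dim;
  tri_base_real : realization D tri_base;
  tri_fine_real : realization D' tri_fine;
  tri_subdivides : subdivides D D' tri_base tri_fine
}.

Definition restriction (R : realType) (V V' : finType)
    (D : simplicial_complex V) (D' : simplicial_complex V')
    (T : triangulation R D D') (F : {set V}) : {set {set V'}} :=
  [set G : {set V'} in faces D' |
    `[< (simplex (tri_fine T) G `<=` simplex (tri_base T) F)%classic >]].

(* None stands for infinity. *)
Definition le_size (n : nat) (d : option nat) : bool :=
  if d is Some m then (n <= m)%N else true.

(* An f-triangle of size d is given by a function f, of which only the values
   f i j with i <= j <= d are used. *)
Definition uniform (d : option nat) (f : nat -> nat -> nat) (R : realType)
    (V V' : finType) (D : simplicial_complex V) (D' : simplicial_complex V')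
    (T : triangulation R D D') : Prop :=
  forall i j : nat, (i <= j)%N -> le_size j d ->
  forall F : {set V}, F \in faces D -> #|F| = j ->
    fnum (restriction T F) i = f i j.

(* Main.v *)
Require Import Defs.
From mathcomp Require Import boolp classical_sets reals.
From mathcomp Require Import all_boot all_order all_algebra.
From mathcomp Require Import ring lra.

(** Let D have rank n. The face numbers of a uniform triangulation D' are
    linear in those of D: sorting the faces of D' by the smallest face F of D
    that carries them, the number of faces with i vertices carried by F is an
    alternating sum of entries of the triangle, hence depends only on i and on
    the cardinality of F. More generally, inside a face with n vertices, the
    number of faces with i vertices that avoid k chosen facets is the k-th
    finite difference [relative_fnum i n k] ([fnum_off_facets]). Rewriting
    face numbers of D in terms of its h-vector turns the sum over F into
    exactly these differences ([sum_coef_bernstein], [fnum_fine]), so that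
    h(D') = sum_k h_k(D) * [relative_hpoly n k], and p(n,k,j) is taken to be the
    j-th coefficient of [relative_hpoly n k]. These polynomials depend on the
    triangle alone.

    The substance is that the coefficients are nonnegative. As soon as one
    complex of rank n has a uniform triangulation, [relative_hpoly n k] is the
    h-polynomial of an actual triangulation Gamma of a simplex with n vertices,
    relative to its restriction to k facets. Instead of using that such a
    relative complex is Cohen-Macaulay, its faces are partitioned into Boolean
    intervals [r G, G], one for each maximal simplex G; an interval contributes
    exactly X^|r G| ([sum_interval]).

    The partition is a half-open decomposition. In barycentric coordinates
    the triangulation becomes a simplicial fan with support the nonnegative
    orthant ([restriction_fan]). Choose a generic vector v that is negative
    precisely in the k coordinates of the avoided facets. Let x be a relatively
    interior point of the cone over a face H. Then x + t v stays in the orthant for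
    small t > 0 if and only if H lies in none of the k facets, and then it lies
    in the interior of the cone over a single maximal simplex G. In terms of
    the coordinates of v in the basis G, this happens for the G that contain H
    and all of whose vertices with a negative coordinate belong to H. So r G is
    the set of these vertices ([fan_half_open]). All sign vectors are
    admissible for v because v is a direction in the cone and not a point of
    the simplex, so avoiding all n facets needs no separate argument. *)

Set Implicit Arguments.
Unset Strict Implicit.
Unset Printing Implicit Defensive.

Import Order.TTheory GRing.Theory Num.Theory.

Local Open Scope ring_scope.

(** * Polynomial identities *)

Definition diff (u : nat -> int) (m : nat) : int := u m.+1 - u m.

(** Multiplying by 1 - X replaces u(m+1) by u(m+1) minus the increment
    u(m+1) - u(m), that is by u(m). *)
Lemma sum_coef_mul1X (u : nat -> int) (n : nat) (q : {poly int}) :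
  (size q <= n.+1)%N ->
  \sum_(k < n.+2) (q * (1 - 'X))`_k * iter k diff u (n.+1 - k)%N =
  \sum_(k < n.+1) q`_k * iter k diff u (n - k)%N.
Proof.
move=> szq.
under eq_bigr => k _ do rewrite mulrBr mulr1 coefB coefMX mulrBl.
rewrite sumrB big_ord_recr /= nth_default // mul0r addr0.
rewrite [X in _ - X]big_ord_recl /= mul0r add0r -sumrB.
apply: eq_bigr => k _; rewrite /bump /= add1n -mulrBr; congr (_ * _).
have kn : (k <= n)%N by rewrite -ltnS.
rewrite subSn // subSS /diff; ring.
Qed.

(** With u(m) = ((1 + diff)^m u)(0) this is the identity which recovers a face
    number from the h-vector: X becomes diff and 1 - X becomes 1 after the
    homogenization by 1 + diff. *)
Lemma sum_coef_bernstein (u : nat -> int) (n m : nat) : (m <= n)%N ->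
  \sum_(k < n.+1) ('X^m * (1 - 'X) ^+ (n - m) : {poly int})`_k *
    iter k diff u (n - k)%N = iter m diff u 0%N.
Proof.
move=> /subnK <-; elim: (n - m)%N => [|e IHe].
  rewrite add0n subnn expr0 mulr1 (bigD1 ord_max) //= subnn coefXn eqxx mul1r.
  rewrite big1 ?addr0 // => k km; rewrite coefXn.
  have -> : (k : nat) == m = false by apply: contraNF km => /eqP km; apply/eqP/val_inj.
  by rewrite mul0r.
rewrite addnK in IHe.
rewrite addnK addSn.
rewrite exprSr mulrA sum_coef_mul1X ?IHe //.
apply: (leq_trans (size_polyMleq _ _)); rewrite size_polyXn /=.
have sz : (size ((1 - 'X) ^+ e : {poly int}) <= e.+1)%N.
  apply: leq_trans (size_poly_exp_leq _ _) _.
  by rewrite -(opprB 'X 1) size_polyN size_XsubC mul1n.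
by rewrite addnC -addSn leq_add2r.
Qed.

(** Choose for each element of G outside r whether it is in H: a binomial
    expansion of (x + y) to the power |G| - |r|. *)
Lemma sum_interval (A : comNzRingType) (W : finType) (r G : {set W}) (x y : A) :
  r \subset G ->
  \sum_(H : {set W} | (r \subset H) && (H \subset G))
     x ^+ #|H| * y ^+ (#|G| - #|H|) = x ^+ #|r| * (x + y) ^+ (#|G| - #|r|).
Proof.
move=> rG.
(* The product of the a w over H and the b w off H is zero unless H is in the
   interval. *)
pose a w := if w \in G then x else 0.
pose b w := if w \in G then if w \in r then 0 else y else 1.
transitivity (\prod_w (a w + b w)).
  rewrite bigA_distr big_mkcond; apply: eq_bigr => H _.
  case: ifP => [/andP[rH HG]|].
    rewrite [RHS](bigID (mem H)) /=; congr (_ * _).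
      rewrite -[LHS]prodr_const; apply: eq_big => // w wH.
      by rewrite wH /a (subsetP HG).
    rewrite -[in LHS](cardsDS HG) -prodr_const [RHS](bigID (mem G)) /=.
    rewrite [X in _ = _ * X]big1 ?mulr1; last first.
      by move=> w /andP[/negPf-> /negPf wG]; rewrite /b wG.
    apply: eq_big => w; first by rewrite !inE.
    rewrite !inE => /andP[wH wG]; rewrite (negPf wH) /b wG.
    by case: ifP => // /(subsetP rH); rewrite (negPf wH).
  move/negbT; rewrite negb_and => /orP[] /subsetPn[w w1 w2].
    by rewrite (bigD1 w) //= (negPf w2) /b w1 (subsetP rG) // mul0r.
  by rewrite (bigD1 w) //= w1 /a (negPf w2) mul0r.
rewrite (bigID (mem r)) /= -[in RHS]prodr_const; congr (_ * _).
  by apply: eq_bigr => w wr; rewrite /a /b wr (subsetP rG) // addr0.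
rewrite -[in RHS](cardsDS rG) -prodr_const [LHS](bigID (mem G)) /=.
rewrite [X in _ * X = _]big1 ?mulr1; last first.
  by move=> w /andP[_ /negPf wG]; rewrite /a /b wG add0r.
apply: eq_big => w; first by rewrite !inE.
by move=> /andP[/negPf wr wG]; rewrite /a /b wr wG.
Qed.

(** * Linear systems and generic vectors *)

Lemma underdetermined_system (K : fieldType) (A B : finType) (S : {set A})
    (E : {set B}) (m : A -> B -> K) : (#|E| < #|S|)%N ->
  exists2 c : A -> K, exists2 a, a \in S & c a != 0 &
    forall e, e \in E -> \sum_(a in S) c a * m a e = 0.
Proof.
move=> ltES.
have /card_gt0P[a0 a0S] : (0 < #|S|)%N by apply: leq_trans ltES.
pose M := \matrix_(i < #|S|, j < #|E|) m (enum_val i) (enum_val j).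
have /matrix0Pn[i [j nz]] : kermx M != 0.
  rewrite kermx_eq0 /row_free neq_ltn (leq_ltn_trans _ ltES) //.
  exact: rank_leq_col.
exists (fun a => kermx M i (enum_rank_in a0S a)).
  by exists (enum_val j); [exact: enum_valP | rewrite enum_valK_in].
move=> e eE; rewrite big_enum_val /=.
have /matrixP/(_ i (enum_rank_in eE e)) := mulmx_ker M.
rewrite !mxE => dep; rewrite -[RHS]dep; apply: eq_bigr => k _.
by rewrite enum_valK_in !mxE enum_rankK_in.
Qed.

Lemma pos_nonroot (R : numDomainType) (p : {poly R}) : p != 0 ->
  exists2 t : R, 0 < t & p.[t] != 0.
Proof.
move=> nzp; apply: contrapT => noroot.
pose s : seq R := [seq i.+1%:R | i <- iota 0 (size p)].
have : (size s < size p)%N.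
  apply: max_poly_roots => //.
    apply/allP => _ /mapP[i _ ->]; apply: contrapT => /negP nr.
    by apply: noroot; exists i.+1%:R; rewrite // ltr0Sn.
  rewrite map_inj_uniq ?iota_uniq // => i j /eqP; rewrite eqr_nat => /eqP.
  by case.
by rewrite size_map size_iota ltnn.
Qed.

(** A nonzero functional vanishes at the point (1, t, t^2, ...) of the moment
    curve, with signs changed on K, for finitely many t only. *)
Lemma generic_vector (R : numFieldType) (I V : finType) (F K : {set V})
    (u : I -> V -> R) :
  (forall i, exists2 a, a \in F & u i a != 0) ->
  exists v : V -> R, [/\ forall a, a \in K -> v a < 0,
    forall a, a \notin K -> 0 < v a &
    forall i, \sum_(a in F) v a * u i a != 0].
Proof.
move=> unz.
(* p i is the value of the functional u i along the signed moment curve. *)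
pose s a : R := (-1) ^+ (a \in K).
pose p i : {poly R} := \sum_(a in F) (s a * u i a) *: 'X^(enum_rank a).
have pnz i : p i != 0.
  have [a aF ua] := unz i; apply: contraNneq ua => /polyP/(_ (enum_rank a)).
  rewrite coef0 coef_sum (bigD1 a) //= coefZ coefXn eqxx mulr1.
  rewrite big1 ?addr0 => [/eqP|c /andP[_ ca]].
    by rewrite mulf_eq0 signr_eq0.
  rewrite coefZ coefXn; have -> : (enum_rank a : nat) == enum_rank c = false.
    by apply: contraNF ca => /eqP/val_inj/enum_rank_inj ->.
  by rewrite mulr0.
have [|t t0 nz] := @pos_nonroot _ (\prod_i p i).
  by apply/prodf_neq0 => i _; exact: pnz.
exists (fun a => s a * t ^+ enum_rank a); split=> [a aK|a /negPf aK|i].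
- by rewrite /s aK mulN1r oppr_lt0 exprn_gt0.
- by rewrite /s aK mul1r exprn_gt0.
move: nz; rewrite horner_prod => /prodf_neq0/(_ i isT).
congr (_ != _); rewrite /p horner_sum; apply: eq_bigr => a _.
by rewrite hornerZ hornerXn mulrAC.
Qed.

(** * Signs of affine functions near zero *)

Section SmallParameter.

Variable R : realFieldType.

Definition for_small (P : R -> Prop) : Prop :=
  exists2 e, 0 < e & forall t, 0 < t -> t <= e -> P t.

Lemma for_small_imply (P Q : R -> Prop) :
  (forall t, 0 < t -> P t -> Q t) -> for_small P -> for_small Q.
Proof. by move=> PQ [e e0 Pe]; exists e => // t t0 te; apply/PQ/Pe. Qed.

Lemma for_small_witness (P : R -> Prop) :
  for_small P -> exists2 t, 0 < t & P t.
Proof. by move=> [e e0 Pe]; exists e => //; apply: Pe. Qed.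

Lemma for_small_and (P Q : R -> Prop) :
  for_small P -> for_small Q -> for_small (fun t => P t /\ Q t).
Proof.
move=> [e e0 Pe] [e' e'0 Qe]; exists (Num.min e e').
  by rewrite lt_min e0.
by move=> t t0; rewrite le_min => /andP[te te']; split; [apply: Pe|apply: Qe].
Qed.

Lemma for_small_forall (I : finType) (P : I -> R -> Prop) :
  (forall i, for_small (P i)) -> for_small (fun t => forall i, P i t).
Proof.
move=> /fin_all_exists2[e e0 Pe]; exists (\big[Num.min/1]_i e i).
  by apply/bigmin_gtP; split.
by move=> t t0 /bigmin_geP[_ te] i; apply: Pe => //; apply: te.
Qed.

(** Positivity of a + t c for all small t > 0. *)
Definition germ_pos (a c : R) : bool := (0 < a) || (a == 0) && (0 < c).

Lemma germ_posP (a c : R) :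
  germ_pos a c -> for_small (fun t => 0 < a + t * c).
Proof.
move=> /orP[a0|/andP[/eqP-> c0]]; last first.
  by exists 1 => // t t0 _; rewrite add0r mulr_gt0.
have [c0|c0] := leP 0 c.
  by exists 1 => // t t0 _; rewrite ltr_wpDr // mulr_ge0 // ltW.
(* The affine function is at least a / 2 up to this value of t. *)
exists (a / (- c *+ 2)) => [|t t0].
  by rewrite divr_gt0 // pmulrn_lgt0 // oppr_gt0.
have nc0 : 0 < - c by rewrite oppr_gt0.
rewrite ler_pdivlMr ?pmulrn_lgt0 //; nra.
Qed.

Lemma germ_pos_total (a c : R) : c != 0 ->
  germ_pos a c || germ_pos (- a) (- c).
Proof. by rewrite /germ_pos !oppr_gt0 oppr_eq0; case: ltgtP => //=; case: ltgtP. Qed.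

Lemma germ_neq0 (a c : R) : c != 0 -> for_small (fun t => a + t * c != 0).
Proof.
move=> /germ_pos_total-/(_ a) /orP[]/germ_posP; apply: for_small_imply => t _.
  exact: lt0r_neq0.
by rewrite mulrN -opprD oppr_gt0 => /ltr0_neq0.
Qed.

Lemma germ_neg (a c : R) : c != 0 -> ~~ germ_pos a c ->
  for_small (fun t => a + t * c < 0).
Proof.
move=> /germ_pos_total-/(_ a) /[swap] /negPf-> /= /germ_posP.
by apply: for_small_imply => t _; rewrite mulrN -opprD oppr_gt0.
Qed.

End SmallParameter.

(** * Half-open decomposition of a fan *)

Section Fan.

Variables (R : realFieldType) (V W : finType) (F : {set V}).
Variables (Gamma : {set {set W}}) (b : W -> V -> R).

Definition comb (G : {set W}) (c : W -> R) (a : V) : R :=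
  \sum_(w in G) c w * b w a.

(** The vectors b w are the rays of a simplicial fan with support the
    nonnegative orthant of R^F, whose cones are indexed by Gamma. The last
    field says that two cones meet in the cone over their common rays, in terms
    of coordinates: a common point has no component along a ray of only one of
    them. *)
Record orthant_fan : Prop := OrthantFan {
  fan_closed : forall G H : {set W}, G \in Gamma -> H \subset G -> H \in Gamma;
  fan_indep : forall G : {set W}, G \in Gamma -> forall c : W -> R,
    {in F, forall a, comb G c a = 0} -> {in G, forall w, c w = 0};
  fan_ge0 : forall G : {set W}, G \in Gamma ->
    {in G & F, forall w a, 0 <= b w a};
  fan_cover : forall y : V -> R, {in F, forall a, 0 <= y a} ->
    exists2 G : {set W}, G \in Gamma & exists2 c : W -> R,
      {in G, forall w, 0 <= c w} & {in F, forall a, y a = comb G c a};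
  fan_inter : forall (G H : {set W}) (c d : W -> R),
    G \in Gamma -> H \in Gamma ->
    {in G, forall w, 0 <= c w} -> {in H, forall w, 0 <= d w} ->
    {in F, forall a, comb G c a = comb H d a} ->
    forall w, w \in G -> w \notin H -> c w = 0
}.

(** Since the rays are nonnegative, these are the faces whose cone lies in none
    of the coordinate hyperplanes indexed by K. *)
Definition off_walls (K : {set V}) : {set {set W}} :=
  [set H in Gamma | [forall a in K, [exists w in H, b w a != 0]]].

Hypothesis fan : orthant_fan.

Lemma comb_linear (G : {set W}) (c d : W -> R) t a :
  comb G (fun w => c w + t * d w) a = comb G c a + t * comb G d a.
Proof.
rewrite /comb mulr_sumr -big_split; apply: eq_bigr => w _ /=.
by rewrite mulrDl mulrA.
Qed.

Lemma comb_sub (G H : {set W}) (c : W -> R) : H \subset G ->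
  comb G (fun w => if w \in H then c w else 0) = comb H c.
Proof.
move=> HG; apply/funext => a; rewrite /comb (big_setID H) /= (setIidPr HG).
rewrite [X in _ + X]big1 ?addr0 => [|w]; last first.
  by rewrite inE => /andP[/negPf-> _]; rewrite mul0r.
by apply: eq_bigr => w ->.
Qed.

Lemma comb_inj (G : {set W}) (c d : W -> R) : G \in Gamma ->
  {in F, forall a, comb G c a = comb G d a} -> {in G, forall w, c w = d w}.
Proof.
move=> GG cd w wG; apply/eqP; rewrite -subr_eq0; apply/eqP.
have := @fan_indep fan G GG (fun w => c w + (-1) * d w).
rewrite -[d w]mul1r -mulNr; apply=> // a aF.
by rewrite comb_linear cd // mulN1r subrr.
Qed.

Lemma fan_card_le (G : {set W}) : G \in Gamma -> (#|G| <= #|F|)%N.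
Proof.
move=> GG; rewrite leqNgt; apply/negP => /(underdetermined_system b).
move=> [c [w wG /eqP cw] cE]; apply: cw.
exact: (fan_indep fan GG).
Qed.

(** Adjoining v to the |F| vectors of G gives more vectors than coordinates,
    and the resulting relation must involve v. *)
Lemma fan_basis (G : {set W}) (v : V -> R) : G \in Gamma -> #|G| = #|F| ->
  exists c : W -> R, {in F, forall a, v a = comb G c a}.
Proof.
move=> GG cardG.
(* None stands for the additional vector v. *)
pose S : {set option W} := None |: (Some @: G).
have NG : None \notin Some @: G by apply/imsetP => -[].
pose m (w : option W) a := if w is Some w then b w a else v a.
have sumS (c : option W -> R) a :
    \sum_(w in S) c w * m w a = c None * v a + comb G (c \o Some) a.
  by rewrite big_setU1 //= big_imset //= => ? ? _ _ [].
have [|c [w wS cw] cE] := @underdetermined_system _ _ _ S F m.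
  by rewrite cardsU1 NG card_imset ?cardG //; exact: Some_inj.
have c0 : c None != 0.
  apply: contraNneq cw => c0; case: w wS => [w|_]; last by rewrite c0.
  rewrite !inE /= => /imsetP[x xG [->]]; apply/eqP.
  apply: (fan_indep fan GG (c := c \o Some)) => // a aF.
  by move: (cE a aF); rewrite sumS c0 mul0r add0r.
exists (fun w => - (c None)^-1 * c (Some w)) => a aF.
have -> : comb G (fun w => - (c None)^-1 * c (Some w)) a =
    - (c None)^-1 * comb G (c \o Some) a.
  by rewrite /comb mulr_sumr; apply: eq_bigr => z _; rewrite mulrA.
have /eqP := cE a aF; rewrite sumS addrC addr_eq0 => /eqP ->.
by rewrite mulrNN mulKf.
Qed.

Variable K : {set V}.
Hypothesis KF : K \subset F.

(** The genericity asked of v is that it avoids the span of every cone of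
    smaller dimension; this is expressed by a functional u that vanishes on the
    cone but not at v. *)
Lemma fan_generic : exists v : V -> R, [/\ forall a, a \in K -> v a < 0,
    forall a, a \notin K -> 0 < v a &
    forall G : {set W}, G \in Gamma -> (#|G| < #|F|)%N -> exists2 u : V -> R,
      forall w, w \in G -> \sum_(a in F) b w a * u a = 0 &
      \sum_(a in F) v a * u a != 0].
Proof.
pose I := {G : {set W} | (#|G| < #|F|)%N}.
have /fin_all_exists2[u unz uE] : forall i : I, exists2 u : V -> R,
    exists2 a, a \in F & u a != 0 &
    forall w, w \in val i -> \sum_(a in F) b w a * u a = 0.
  move=> [G ltG] /=.
  have [u unz uE] := underdetermined_system (fun a w => b w a) ltG.
  by exists u => // w wG; rewrite -[RHS](uE w wG); apply: eq_bigr => *; rewrite mulrC.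
have [v [vK vNK vu]] := generic_vector K unz.
exists v; split=> // G _ ltG; exists (u (exist _ G ltG)) => // w wG.
exact: (uE (exist _ G ltG)).
Qed.

Lemma comb_dual (G : {set W}) (c : W -> R) (u : V -> R) :
  (forall w, w \in G -> \sum_(a in F) b w a * u a = 0) ->
  \sum_(a in F) comb G c a * u a = 0.
Proof.
move=> uG; under eq_bigr do rewrite /comb mulr_suml.
rewrite exchange_big big1 //= => w wG.
under eq_bigr do rewrite -mulrA.
by rewrite -mulr_sumr uG // mulr0.
Qed.

(** The intervals [r G, G], for G of full dimension, partition the faces off
    the walls in K: a point of the cone over H, moved slightly along a generic
    vector which points out of the orthant through the walls in K only, enters
    the interior of exactly one cone. *)
Theorem fan_half_open : exists r : {set W} -> {set W},
  [/\ forall G : {set W}, r G \subset G,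
      forall G H : {set W}, G \in Gamma -> #|G| = #|F| -> r G \subset H ->
        H \subset G -> H \in off_walls K,
      forall H : {set W}, H \in off_walls K -> exists G : {set W},
        [/\ G \in Gamma, #|G| = #|F|, r G \subset H & H \subset G] &
      forall G1 G2 H : {set W}, G1 \in Gamma -> G2 \in Gamma ->
        #|G1| = #|F| -> #|G2| = #|F| ->
        r G1 \subset H -> H \subset G1 -> r G2 \subset H -> H \subset G2 ->
        G1 = G2].
Proof.
have [v [vK vNK vgen]] := fan_generic.
have /fin_all_exists[c cE] : forall G : {set W}, exists c : W -> R,
    G \in Gamma -> #|G| = #|F| -> {in F, forall a, v a = comb G c a}.
  move=> G; have [GG|/negP GG] := boolP (G \in Gamma); last by exists (fun=> 0).
  have [cG|/eqP cG] := eqVneq #|G| #|F|; last by exists (fun=> 0).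
  by have [c cE] := fan_basis v GG cG; exists c.
(* A vanishing coordinate would put v in the span of a smaller cone. *)
have c_neq0 G : G \in Gamma -> #|G| = #|F| -> forall w, w \in G -> c G w != 0.
  move=> GG cG w wG; apply/eqP => cw0.
  have [||u uG /eqP[]] := vgen (G :\ w).
  - exact: fan_closed GG (subD1set _ _).
  - by rewrite -cG (cardsD1 w G) wG.
  rewrite -[RHS](comb_dual (c G) uG); apply: eq_bigr => a aF.
  by rewrite (cE G) // /comb (big_setD1 w) //= cw0 mul0r add0r.
pose r (G : {set W}) := [set w in G | c G w < 0].
pose chi (H : {set W}) w : R := if w \in H then 1 else 0.
(* x H is an interior point of the cone over H, and chi H lists its
   coordinates in any basis G that contains H. *)
pose x H a := comb H (fun=> 1) a.
have xchi (G H : {set W}) : H \subset G -> comb G (chi H) = x H by exact: comb_sub.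
have xG (G H : {set W}) t a : G \in Gamma -> #|G| = #|F| -> H \subset G -> a \in F ->
    x H a + t * v a = comb G (fun w => chi H w + t * c G w) a.
  by move=> GG cG HG aF; rewrite comb_linear xchi // -cE.
have chi_pos (G H : {set W}) : G \in Gamma -> #|G| = #|F| -> r G \subset H ->
    for_small (fun t => {in G, forall w, 0 < chi H w + t * c G w}).
  move=> GG cG rH; apply: for_small_forall => w.
  have [wG|_] := boolP (w \in G); last by exists 1.
  have gp : germ_pos (chi H w) (c G w).
    rewrite /chi /germ_pos; case: ifPn => [_|wH]; first by rewrite ltr01.
    rewrite ltxx eqxx /= lt0r c_neq0 //= leNgt; apply: contra wH => cw.
    by apply: (subsetP rH); rewrite inE wG.
  by apply: for_small_imply (germ_posP gp).
exists r; split.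
- by move=> G; apply/subsetP => w; rewrite inE => /andP[].
- move=> G H GG cG rH HG; have HGam := fan_closed fan GG HG.
  rewrite inE HGam /=; apply/forall_inP => a aK; apply/exists_inP.
  apply: contrapT => noH; have aF := subsetP KF a aK.
  (* If H were in the wall a, then x H + t v, which lies in the cone over G,
     would have the negative a-th coordinate t * v a. *)
  have [t t0 tG] := for_small_witness (chi_pos G H GG cG rH).
  have : 0 <= x H a + t * v a.
    rewrite (xG G) // sumr_ge0 // => w wG.
    by rewrite mulr_ge0 ?(fan_ge0 fan GG) // ltW // tG.
  rewrite /x /comb big1 ?add0r => [|w wH].
    by rewrite pmulr_rge0 // leNgt vK.
  rewrite mul1r; apply: contrapT => /eqP bw; apply: noH; by exists w.
- move=> H; rewrite inE => /andP[HGam /forall_inP Hoff].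
  have x_ge0 a : a \in F -> 0 <= x H a.
    move=> aF; rewrite sumr_ge0 // => w wH.
    by rewrite mul1r (fan_ge0 fan HGam).
  (* For small t the point x H + t v is in the orthant (s1), off the smaller
     cones (s2), and the signs of its coordinates in each basis are decided by
     their expansion in t (s3). *)
  have s1 : for_small (fun t => {in F, forall a, 0 < x H a + t * v a}).
    apply: for_small_forall => a; have [aF|_] := boolP (a \in F); last by exists 1.
    suff gp : germ_pos (x H a) (v a) by apply: for_small_imply (germ_posP gp).
    rewrite /germ_pos lt0r x_ge0 // andbT; case: eqVneq => //= xa0.
    apply: vNK; apply: contraPN xa0 => aK; apply/eqP.
    have /exists_inP[w wH bw] := Hoff a aK.
    rewrite /x /comb (bigD1 w) //= mul1r gt_eqF // ltr_wpDr //.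
      apply: sumr_ge0 => w' /andP[w'H _]; by rewrite mul1r (fan_ge0 fan HGam).
    by rewrite lt0r bw (fan_ge0 fan HGam).
  have s2 : for_small (fun t => forall G : {set W}, G \in Gamma ->
      (#|G| < #|F|)%N -> forall d, ~ {in F, forall a, x H a + t * v a = comb G d a}).
    apply: for_small_forall => G.
    have [GG|/negP GG] := boolP (G \in Gamma); last by exists 1.
    have [ltG|geG] := ltnP #|G| #|F|; last by exists 1.
    have [u uG uv] := vgen G GG ltG.
    apply: for_small_imply (germ_neq0 (\sum_(a in F) x H a * u a) uv).
    move=> t _ /eqP nz _ _ d dE; apply: nz.
    rewrite -[RHS](comb_dual (d) uG) mulr_sumr -big_split.
    by apply: eq_bigr => a aF; rewrite -dE //= mulrDl mulrA.
  have /fin_all_exists[d dE] : forall G : {set W}, exists d : W -> R,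
      G \in Gamma -> #|G| = #|F| -> {in F, forall a, x H a = comb G d a}.
    move=> G; have [GG|/negP GG] := boolP (G \in Gamma); last by exists (fun=> 0).
    have [cG|/eqP cG] := eqVneq #|G| #|F|; last by exists (fun=> 0).
    by have [d dE] := fan_basis (x H) GG cG; exists d.
  have s3 : for_small (fun t => forall G : {set W}, G \in Gamma ->
      #|G| = #|F| -> forall w, w \in G ->
      0 <= d G w + t * c G w -> germ_pos (d G w) (c G w)).
    apply: for_small_forall => G.
    have [GG|/negP GG] := boolP (G \in Gamma); last by exists 1.
    have [cG|/eqP cG] := eqVneq #|G| #|F|; last by exists 1.
    suff: for_small (fun t => forall w, w \in G ->
        0 <= d G w + t * c G w -> germ_pos (d G w) (c G w)).
      by apply: for_small_imply => t _ + _ _.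
    apply: for_small_forall => w.
    have [wG|/negP wG] := boolP (w \in G); last by exists 1.
    have [gp|ngp] := boolP (germ_pos (d G w) (c G w)); first by exists 1.
    apply: for_small_imply (germ_neg (c_neq0 G GG cG w wG) ngp) => t _ neg _.
    by rewrite leNgt neg.
  have [t t0 [xpos [low top]]] :=
    for_small_witness (for_small_and s1 (for_small_and s2 s3)).
  (* The cone that contains x H + t v has full dimension and contains
     x H too. *)
  have [|G GG [e e0 eE]] := fan_cover fan (y := fun a => x H a + t * v a).
    by move=> a aF; rewrite ltW ?xpos.
  have cG : #|G| = #|F|.
    apply/eqP; rewrite eqn_leq fan_card_le //= leqNgt; apply/negP => ltG.
    exact: (low G GG ltG e).
  have eG : {in G, forall w, e w = d G w + t * c G w}.
    apply: comb_inj => // a aF.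
    by rewrite comb_linear -dE // -cE // -eE.
  have gp w : w \in G -> germ_pos (d G w) (c G w).
    by move=> wG; apply: top => //; rewrite -eG ?e0.
  have d0 w : w \in G -> 0 <= d G w.
    by move=> /gp /orP[/ltW|/andP[/eqP->]].
  have HG : H \subset G.
    apply/subsetP => w wH; apply: contrapT => /negP wG.
    have/eqP := @fan_inter fan H G (fun=> 1) (d G) HGam GG
      (fun _ _ => ler01) d0 (fun a aF => dE G GG cG a aF) w wH wG.
    by rewrite oner_eq0.
  have dchi : {in G, forall w, d G w = chi H w}.
    by apply: comb_inj => // a aF; rewrite xchi // -dE.
  exists G; split=> //; apply/subsetP => w; rewrite inE => /andP[wG cw].
  apply: contrapT => /negP /negPf wH; have := gp w wG.
  by rewrite dchi // /chi wH /germ_pos ltxx eqxx /= ltNge ltW.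
move=> G1 G2 H GG1 GG2 cG1 cG2 rH1 HG1 rH2 HG2.
have [t t0 [p1 p2]] :=
  for_small_witness (for_small_and (chi_pos _ _ GG1 cG1 rH1) (chi_pos _ _ GG2 cG2 rH2)).
have sub (G G' : {set W}) : G \in Gamma -> G' \in Gamma -> #|G| = #|F| -> #|G'| = #|F| ->
    H \subset G -> H \subset G' ->
    {in G, forall w, 0 < chi H w + t * c G w} ->
    {in G', forall w, 0 < chi H w + t * c G' w} -> G \subset G'.
  move=> GG GG' cG cG' HG HG' p p'; apply/subsetP => w wG.
  apply: contrapT => /negP wG'.
  have := @fan_inter fan G G' _ _ GG GG' (fun w wG => ltW (p w wG))
    (fun w wG => ltW (p' w wG)).
  move=> /(_ _ w wG wG')/eqP; rewrite gt_eqF ?p //.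
  suff h : {in F, forall a, comb G (fun w => chi H w + t * c G w) a =
    comb G' (fun w => chi H w + t * c G' w) a} by move=> /(_ h).
  by move=> a aF; rewrite -!xG.
apply/eqP; rewrite eqEsubset (sub G1 G2 GG1 GG2 cG1 cG2 HG1 HG2 p1 p2).
exact: (sub G2 G1 GG2 GG1 cG2 cG1 HG2 HG1 p2 p1).
Qed.

Corollary off_walls_hpoly : exists r : {set W} -> nat,
  \sum_(H in off_walls K) 'X^#|H| * (1 - 'X) ^+ (#|F| - #|H|) =
  \sum_(G in Gamma | #|G| == #|F|) 'X^(r G) :> {poly int}.
Proof.
have [r [rsub inoff cover uniq]] := fan_half_open.
exists (fun G => #|r G|).
pose big G := (G \in Gamma) && (#|G| == #|F|).
transitivity (\sum_(H in off_walls K) \sum_(G | big G && ((r G \subset H) && (H \subset G)))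
    'X^#|H| * (1 - 'X) ^+ (#|F| - #|H|) : {poly int}).
  apply: eq_bigr => H /cover[G [GG cG rH HG]].
  rewrite (bigD1 G) /=; last by rewrite /big GG cG eqxx rH HG.
  rewrite big1 ?addr0 // => G' /andP[/andP[/andP[GG' /eqP cG'] /andP[rH' HG']]].
  by rewrite (uniq G' G H) ?eqxx.
rewrite (exchange_big_dep big) /=; last by move=> H G _ /andP[].
apply: eq_bigr => G /andP[GG /eqP cG].
transitivity (\sum_(H : {set W} | (r G \subset H) && (H \subset G))
    'X^#|H| * (1 - 'X) ^+ (#|G| - #|H|) : {poly int}).
  rewrite -cG; apply: eq_bigl => H; rewrite /big GG cG eqxx /=.
  by apply: andb_idl => /andP[rH HG]; exact: (inoff G).
by rewrite sum_interval // addrC subrK expr1n mulr1.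
Qed.

End Fan.

(** * Triangulations of a simplex as fans *)

Section Simplices.

Variables (R : realType) (N : nat) (V : finType) (phi : V -> 'rV[R]_N).

Definition barycentric (F : {set V}) (x : 'rV[R]_N) (c : V -> R) : Prop :=
  [/\ forall v, v \in F -> 0 <= c v, \sum_(v in F) c v = 1 &
      x = \sum_(v in F) c v *: phi v].

Lemma aff_indep_inj (F : {set V}) (c d : V -> R) : aff_indep phi F ->
  \sum_(v in F) c v = \sum_(v in F) d v ->
  \sum_(v in F) c v *: phi v = \sum_(v in F) d v *: phi v ->
  {in F, forall v, c v = d v}.
Proof.
move=> indep cd cdphi v vF; apply/eqP; rewrite -subr_eq0; apply/eqP.
apply: (indep (fun v => c v - d v)) => //.
  by rewrite sumrB cd subrr.
under eq_bigr do rewrite scalerBl.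
by rewrite sumrB cdphi subrr.
Qed.

Definition extend (F : {set V}) (c : V -> R) (v : V) : R :=
  if v \in F then c v else 0.

Lemma barycentric_extend (E F : {set V}) x c :
  E \subset F -> barycentric E x c -> barycentric F x (extend E c).
Proof.
move=> EF [c0 c1 cx]; split=> [v _||].
- by rewrite /extend; case: ifP => // /c0.
- rewrite (big_setID E) /= (setIidPr EF) [X in _ + X]big1 ?addr0 => [|v].
    by rewrite -[RHS]c1; apply: eq_bigr => v vE; rewrite /extend vE.
  by rewrite inE /extend => /andP[/negPf->].
rewrite (big_setID E) /= (setIidPr EF) [X in _ + X]big1 ?addr0 => [|v].
  by rewrite cx; apply: eq_bigr => v vE; rewrite /extend vE.
by rewrite inE /extend => /andP[/negPf-> _]; rewrite scale0r.
Qed.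

Lemma barycentric_shrink (E F : {set V}) x c : E \subset F ->
  (forall v, v \in F -> v \notin E -> c v = 0) ->
  barycentric F x c -> barycentric E x c.
Proof.
move=> EF cE [c0 c1 cx]; split=> [v vE||].
- exact/c0/(subsetP EF).
- rewrite -c1 [RHS](big_setID E) /= (setIidPr EF) [X in _ + X]big1 ?addr0 // => v.
  by rewrite inE => /andP[vE vF]; apply: cE.
rewrite cx (big_setID E) /= (setIidPr EF) [X in _ + X]big1 ?addr0 // => v.
by rewrite inE => /andP[vE vF]; rewrite cE // scale0r.
Qed.

Lemma simplexS (E F : {set V}) : E \subset F ->
  (simplex phi E `<=` simplex phi F)%classic.
Proof. by move=> EF x [c cx]; exists (extend E c); apply: barycentric_extend. Qed.

Lemma simplex_vertex (F : {set V}) v : v \in F -> simplex phi F (phi v).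
Proof.
move=> vF; exists (fun w => (w == v)%:R); split=> [w _||].
- exact: ler0n.
- rewrite (bigD1 v) //= eqxx big1 ?addr0 // => w /andP[_ /negPf->]; exact: mulr0n.
rewrite (bigD1 v) //= eqxx scale1r big1 ?addr0 // => w /andP[_ /negPf->].
by rewrite scale0r.
Qed.

(** By uniqueness, the coordinates of a point of a face vanish off the face. *)
Lemma barycentric_face (E F : {set V}) x c : aff_indep phi F -> E \subset F ->
  barycentric F x c -> simplex phi E x ->
  forall v, v \in F -> v \notin E -> c v = 0.
Proof.
move=> indep EF [c0 c1 cx] [d /(barycentric_extend EF)[d0 d1 dx]] v vF vE.
rewrite (aff_indep_inj indep (c := c) (d := extend E d)) -?cx ?c1 ?d1 //.
by rewrite /extend (negPf vE).
Qed.

Section Change.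

Variables (W : finType) (psi : W -> 'rV[R]_N) (b : W -> V -> R).
Variables (F : {set V}) (G : {set W}) (c : W -> R).
Hypothesis bary : forall w, w \in G -> barycentric F (psi w) (b w).

Lemma sum_comb : \sum_(a in F) comb b G c a = \sum_(w in G) c w.
Proof.
rewrite exchange_big /=; apply: eq_bigr => w wG.
by have [_ b1 _] := bary wG; rewrite -mulr_sumr b1 mulr1.
Qed.

Lemma sum_comb_scale :
  \sum_(a in F) comb b G c a *: phi a = \sum_(w in G) c w *: psi w.
Proof.
under eq_bigr do rewrite scaler_suml.
rewrite exchange_big /=; apply: eq_bigr => w wG.
have [_ _ ->] := bary wG; rewrite scaler_sumr.
by apply: eq_bigr => a aF; rewrite scalerA.
Qed.

End Change.

Lemma simplex_hull (W : finType) (psi : W -> 'rV[R]_N) (F : {set V})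
    (G : {set W}) : (forall w, w \in G -> simplex phi F (psi w)) ->
  (simplex psi G `<=` simplex phi F)%classic.
Proof.
move=> GF x [c [c0 c1 cx]].
have /fin_all_exists[b bE] : forall w, exists b : V -> R,
    w \in G -> barycentric F (psi w) b.
  move=> w; have [wG|/negP wG] := boolP (w \in G); last by exists (fun=> 0).
  by have [b bE] := GF w wG; exists b.
exists (comb b G c); split=> [a aF||].
- rewrite sumr_ge0 // => w wG.
  by have [b0 _ _] := bE w wG; rewrite mulr_ge0 ?c0 ?b0.
- by rewrite (sum_comb (psi := psi)).
- by rewrite (sum_comb_scale (psi := psi)).
Qed.

End Simplices.

Section Restriction.

Variables (R : realType) (V W : finType).
Variables (D : simplicial_complex V) (D' : simplicial_complex W).
Variable T : triangulation R D D'.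

Let phi := tri_base T.
Let psi := tri_fine T.

Lemma restrictionP (F : {set V}) (G : {set W}) :
  reflect (G \in faces D' /\ forall w, w \in G -> simplex phi F (psi w))
    (G \in restriction T F).
Proof.
rewrite inE; apply: (iffP andP) => -[GD' GF]; split=> //.
  by move=> w wG; move/asboolP: GF; apply; apply: simplex_vertex.
by apply/asboolP; apply: simplex_hull.
Qed.

Lemma restrictionI (E F : {set V}) : E \in faces D -> F \in faces D ->
  restriction T E :&: restriction T F = restriction T (E :&: F).
Proof.
move=> ED FD; have [_ inter] := tri_base_real T.
apply/setP => G; rewrite inE; apply/andP/restrictionP.
  move=> [/restrictionP[GD' GE] /restrictionP[_ GF]]; split=> // w wG.
  by rewrite -inter //; split; [apply: GE|apply: GF].
move=> [GD' GEF]; split; apply/restrictionP; split=> // w wG;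
  apply: simplexS (GEF w wG); [exact: subsetIl|exact: subsetIr].
Qed.

Lemma restriction_cover (G : {set W}) : G \in faces D' ->
  exists2 F, F \in faces D & G \in restriction T F.
Proof.
move=> GD'; have [sub _] := tri_subdivides T; have [F FD GF] := sub G GD'.
exists F => //; apply/restrictionP; split=> // w wG.
by apply: GF; apply: simplex_vertex.
Qed.

Lemma restriction_closed (F : {set V}) (G H : {set W}) :
  G \in restriction T F -> H \subset G -> H \in restriction T F.
Proof.
move=> /restrictionP[GD' GF] HG; apply/restrictionP; split.
  exact: face_closed GD' HG.
by move=> w /(subsetP HG)/GF.
Qed.

Variable F : {set V}.
Hypothesis FD : F \in faces D.

(** The vertices of G that have positive weight in a point x of F all lie in F:
    in a face E of D that carries G, the coordinates of x off F are positive
    combinations of those of these vertices, and they vanish. *)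
Lemma restriction_carrier (G : {set W}) (c : W -> R) (x : 'rV[R]_(tri_dim T)) :
  G \in faces D' -> barycentric psi G x c -> simplex phi F x ->
  [set w in G | c w != 0] \in restriction T F.
Proof.
move=> GD' Gx Fx; have [indep inter] := tri_base_real T.
have [E ED /restrictionP[_ GE]] := restriction_cover GD'.
have /fin_all_exists[b bE] : forall w, exists b : V -> R,
    w \in G -> barycentric phi E (psi w) b.
  move=> w; have [wG|/negP wG] := boolP (w \in G); last by exists (fun=> 0).
  by have [b bE] := GE w wG; exists b.
have b0 w a : w \in G -> a \in E -> 0 <= b w a.
  by move=> wG aE; have [b0 _ _] := bE w wG; exact: b0.
have [c0 c1 cx] := Gx.
have Ex : barycentric phi E x (comb b G c).
  split=> [a aE||].
  - by rewrite sumr_ge0 // => w wG; rewrite mulr_ge0 ?c0 ?b0.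
  - by rewrite (sum_comb _ bE).
  - by rewrite (sum_comb_scale _ bE).
have EFx : simplex phi (E :&: F) x.
  by rewrite -inter //; split=> //; exists (comb b G c).
have off := barycentric_face (indep E ED) (subsetIl E F) Ex EFx.
apply/restrictionP; split.
  by apply: face_closed GD' _; apply/subsetP => w; rewrite inE => /andP[].
move=> w; rewrite inE => /andP[wG cw].
apply: (simplexS (subsetIr E F)); exists (b w).
apply: barycentric_shrink (bE w wG) => [|a aE aEF]; first exact: subsetIl.
have /eqP := off a aE aEF; rewrite psumr_eq0 => [|z zG]; last first.
  by rewrite mulr_ge0 ?c0 ?b0.
move=> /allP/(_ w); rewrite mem_index_enum wG mulf_eq0 (negPf cw) /=.
by move=> /(_ isT)/eqP.
Qed.

Variable b : W -> V -> R.
Hypothesis bary : forall w, simplex phi F (psi w) -> barycentric phi F (psi w) (b w).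

Lemma restriction_bary (G : {set W}) : G \in restriction T F ->
  forall w, w \in G -> barycentric phi F (psi w) (b w).
Proof. by move=> /restrictionP[_ GF] w wG; apply/bary/GF. Qed.

(** Points of the simplex F correspond to the points with coordinate sum 1 of
    the orthant, and the conditions on a fan are those on a triangulation after
    scaling to this sum. The points with sum 0, where scaling is impossible, are
    only the origin. *)
Lemma restriction_fan : orthant_fan F (restriction T F) b.
Proof.
have [indep' inter'] := tri_fine_real T.
have [indep inter] := tri_base_real T.
split.
- exact: restriction_closed.
- move=> G GF c c0; have bG := restriction_bary GF.
  have [GD' _] := restrictionP _ _ GF.
  apply: (indep' G GD' c).
    by rewrite -(sum_comb c bG) big1.
  by rewrite -(sum_comb_scale c bG) big1 // => a aF; rewrite c0 // scale0r.
- by move=> G GF w a wG aF; have [b0 _ _] := restriction_bary GF wG; exact: b0.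
- move=> y y0; pose s := \sum_(a in F) y a.
  have [s0|s_neq0] := eqVneq s 0.
    exists finset.set0.
      apply/restrictionP; split; first exact: face_empty.
      by move=> w; rewrite inE.
    exists (fun=> 0) => // a aF; rewrite /comb big_set0.
    apply/eqP; move/eqP: s0; rewrite psumr_eq0 // => /allP/(_ a).
    by rewrite mem_index_enum aF; apply.
  have s_ge0 : 0 <= s by apply: sumr_ge0.
  have s_gt0 : 0 < s by rewrite lt0r s_neq0.
  pose x := \sum_(a in F) (y a / s) *: phi a.
  have Fx : barycentric phi F x (fun a => y a / s).
    split=> // [a aF|]; first by rewrite divr_ge0 ?y0.
    by rewrite -mulr_suml divff.
  have [_ poly] := tri_subdivides T.
  have [G GD' [c Gx]] : polyhedron (faces D') psi x.
    by rewrite poly; exists F => //; exists (fun a => y a / s).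
  have GF := restriction_carrier GD' Gx (ex_intro _ _ Fx).
  have [c0 c1 cx] : barycentric psi [set w in G | c w != 0] x c.
    apply: barycentric_shrink Gx => [|w wG].
      by apply/subsetP => w; rewrite inE => /andP[].
    by rewrite inE wG negbK => /eqP.
  exists [set w in G | c w != 0] => //; exists (fun w => s * c w) => [w wG|a aF].
    by rewrite mulr_ge0 // c0.
  have bG := restriction_bary GF.
  have -> : y a = s * (y a / s) by rewrite mulrC divfK.
  have [_ y1 yx] := Fx.
  rewrite (aff_indep_inj (indep F FD) (c := fun a => y a / s)
    (d := comb b [set w in G | c w != 0] c)) //.
  + by rewrite /comb mulr_sumr; apply: eq_bigr => w _; rewrite mulrA.
  + by rewrite (sum_comb _ bG) y1 c1.
  by rewrite (sum_comb_scale _ bG) -yx cx.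
- move=> G H c d GF HF c0 d0 cd w wG wH.
  have bG := restriction_bary GF; have bH := restriction_bary HF.
  have [GD' _] := restrictionP _ _ GF; have [HD' _] := restrictionP _ _ HF.
  pose s := \sum_(w in G) c w.
  have sd : s = \sum_(w in H) d w.
    by rewrite /s -(sum_comb c bG) -(sum_comb d bH); apply: eq_bigr.
  have [s0|s_neq0] := eqVneq s 0.
    apply/eqP; move/eqP: s0; rewrite psumr_eq0 // => /allP/(_ w).
    by rewrite mem_index_enum wG; apply.
  have s_ge0 : 0 <= s by apply: sumr_ge0.
  pose x := s^-1 *: \sum_(a in F) comb b G c a *: phi a.
  have Gx : barycentric psi G x (fun w => s^-1 * c w).
    split=> [z zG||]; first by rewrite mulr_ge0 ?invr_ge0 ?c0.
      by rewrite -mulr_sumr mulVf.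
    rewrite /x (sum_comb_scale c bG) scaler_sumr.
    by apply: eq_bigr => z _; rewrite scalerA.
  have Hx : barycentric psi H x (fun w => s^-1 * d w).
    split=> [z zG||]; first by rewrite mulr_ge0 ?invr_ge0 ?d0.
      by rewrite -mulr_sumr -sd mulVf.
    have -> : x = s^-1 *: \sum_(a in F) comb b H d a *: phi a.
      by congr (_ *: _); apply: eq_bigr => a aF; rewrite cd.
    rewrite (sum_comb_scale d bH) scaler_sumr.
    by apply: eq_bigr => z _; rewrite scalerA.
  have GHx : simplex psi (G :&: H) x.
    by rewrite -inter' //; split; eexists; [exact: Gx|exact: Hx].
  have := barycentric_face (indep' G GD') (subsetIl G H) Gx GHx wG.
  rewrite inE wG (negPf wH) => /(_ isT)/eqP.
  by rewrite mulf_eq0 invr_eq0 (negPf s_neq0) => /eqP.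
Qed.

Lemma restriction_wall (G : {set W}) (a : V) : G \in restriction T F ->
  a \in F -> (G \in restriction T (F :\ a)) = [forall w in G, b w a == 0].
Proof.
move=> GF aF; have [indep _] := tri_base_real T.
have bG := restriction_bary GF; have [GD' _] := restrictionP _ _ GF.
apply/restrictionP/forall_inP => [[_ Ga] w wG|ba].
  apply/eqP; apply: (barycentric_face (indep F FD) _ (bG w wG) (Ga w wG)) => //.
    exact: subD1set.
  by rewrite !inE eqxx.
split=> // w wG; exists (b w); apply: barycentric_shrink (bG w wG).
  exact: subD1set.
by move=> v vF; rewrite !inE vF andbT negbK => /eqP->; apply/eqP/ba.
Qed.

End Restriction.

(** * Faces of a triangulated simplex off some facets *)

Section RelativeHpoly.

Variables (R : realType) (V W : finType).
Variables (D : simplicial_complex V) (D' : simplicial_complex W).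
Variable T : triangulation R D D'.

Definition off_facets (F K : {set V}) : {set {set W}} :=
  [set G in restriction T F | [forall a in K, G \notin restriction T (F :\ a)]].

Lemma in_off_facets (F K : {set V}) (G : {set W}) :
  (G \in off_facets F K) =
  (G \in restriction T F) && [forall a in K, G \notin restriction T (F :\ a)].
Proof. exact: in_set. Qed.

Lemma restriction_is_fan (F : {set V}) : F \in faces D ->
  exists2 b : W -> V -> R, orthant_fan F (restriction T F) b &
    forall K : {set V}, K \subset F ->
      off_facets F K = off_walls (restriction T F) b K.
Proof.
move=> FD.
have /fin_all_exists[b bE] : forall w, exists b : V -> R,
    simplex (tri_base T) F (tri_fine T w) ->
    barycentric (tri_base T) F (tri_fine T w) b.
  move=> w; have [[b bE]|nFw] := pselect (simplex (tri_base T) F (tri_fine T w)).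
    by exists b.
  by exists (fun=> 0).
exists b; first exact: restriction_fan.
move=> K KF; apply/setP => G; rewrite in_off_facets [RHS]in_set; apply: andb_id2l => GF.
apply: eq_forallb_in => a aK.
by rewrite (restriction_wall FD bE GF) ?(subsetP KF) // negb_forall_in.
Qed.

Lemma restriction_card_le (F : {set V}) (G : {set W}) : F \in faces D ->
  G \in restriction T F -> (#|G| <= #|F|)%N.
Proof. by move=> /restriction_is_fan[b fan _] GF; exact: (fan_card_le fan GF). Qed.

(** Every face off the empty set of facets, for instance the empty face, lies
    in some interval, hence in a simplex of full dimension. *)
Lemma restriction_facet (F : {set V}) : F \in faces D ->
  exists2 G, G \in restriction T F & #|G| = #|F|.
Proof.
move=> /restriction_is_fan[b fan _].
have [r [_ _ cover _]] := fan_half_open fan (sub0set F).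
have [|G [GF cG _ _]] := cover finset.set0; last by exists G.
rewrite inE; apply/andP; split; last by apply/forall_inP => a; rewrite inE.
have [G GF _] := fan_cover fan (y := fun=> 0) (fun _ _ => lexx 0).
exact: fan_closed fan _ _ GF (sub0set G).
Qed.

Lemma off_facets_hpoly (F K : {set V}) (j : nat) :
  F \in faces D -> K \subset F ->
  0 <= (\sum_(G in off_facets F K) 'X^#|G| * (1 - 'X) ^+ (#|F| - #|G|)
         : {poly int})`_j.
Proof.
move=> /restriction_is_fan[b fan offE] KF; rewrite offE //.
have [r ->] := off_walls_hpoly fan KF; rewrite coef_sum sumr_ge0 // => G _.
by rewrite coefXn ler0n.
Qed.

End RelativeHpoly.

(** * Counting faces by their carrier *)

Lemma sum_by_card (W : finType) (A : {set {set W}}) (M : nmodType)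
    (P : nat -> M) (n : nat) :
  (forall G, G \in A -> (#|G| <= n)%N) ->
  \sum_(G in A) P #|G| = \sum_(i < n.+1) P i *+ fnum A i.
Proof.
move=> An; rewrite (partition_big (fun G : {set W} => inord #|G| : 'I_n.+1) predT) //=.
apply: eq_bigr => i _.
rewrite (eq_bigl (fun G => G \in [set G : {set W} in A | #|G| == i])) => [|G]; last first.
  rewrite !inE; apply: andb_id2l => GA.
  by rewrite -val_eqE /= inordK // ltnS An.
rewrite (eq_bigr (fun=> P i)) => [|G]; last by rewrite inE => /andP[_ /eqP->].
by rewrite sumr_const.
Qed.

Lemma fnumID (W : finType) (A B : {set {set W}}) (i : nat) :
  fnum A i = (fnum (A :&: B) i + fnum (A :\: B) i)%N.
Proof.
rewrite /fnum -(cardsID B); congr addn; apply: eq_card => G.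
  by rewrite !inE andbAC.
by rewrite !inE andbA.
Qed.

Lemma rank_attained (V : finType) (D : simplicial_complex V) :
  exists2 F, F \in faces D & #|F| = rank D.
Proof.
have D0 : (0 < #|faces D|)%N by apply/card_gt0P; exists finset.set0; exact: face_empty.
have [F FD rF] := eq_bigmax_cond (fun F : {set V} => #|F|) D0.
by exists F; rewrite /rank ?rF.
Qed.

Section Counting.

Variables (R : realType) (V W : finType).
Variables (D : simplicial_complex V) (D' : simplicial_complex W).
Variable T : triangulation R D D'.

(** The faces off the facets opposite to K without a split into those inside
    the facet opposite to a and those off it as well. This is the recursion
    solved by finite differences. *)
Lemma off_facets_setD1 (F K : {set V}) (a : V) :
  F \in faces D -> K \subset F -> a \in K ->
  off_facets T F (K :\ a) :&: restriction T (F :\ a) =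
    off_facets T (F :\ a) (K :\ a) /\
  off_facets T F (K :\ a) :\: restriction T (F :\ a) = off_facets T F K.
Proof.
move=> FD KF aK.
have faceD c : F :\ c \in faces D by apply: face_closed FD (subD1set _ _).
have sub : restriction T (F :\ a) \subset restriction T F.
  by rewrite -(setIidPr (subD1set F a)) -restrictionI // subsetIl.
have rI (c : V) : restriction T (F :\ a :\ c) =
    restriction T (F :\ a) :&: restriction T (F :\ c).
  rewrite restrictionI //; congr (restriction T _).
  by apply/setP => v; rewrite !inE; case: (v \in F); rewrite ?andbT ?andbF // andbC.
split; apply/setP => G; rewrite [LHS]in_setI || rewrite [LHS]in_setD.
  rewrite !in_off_facets andbAC.
  have [Ga|] := boolP (G \in restriction T (F :\ a)); last by rewrite andbF.
  rewrite (subsetP sub) //=; apply: eq_forallb_in => c cK.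
  by rewrite rI in_setI Ga.
rewrite !in_off_facets andbCA. apply: andb_id2l => GF.
apply/andP/forall_inP => [[Ga /forall_inP GK] c cK|GK].
  by have [->//|ca] := eqVneq c a; apply: GK; rewrite !inE ca.
split; first exact: GK.
by apply/forall_inP => c; rewrite in_setD1 => /andP[_]; exact: GK.
Qed.

(** A face G of D' lies off all the facets of F exactly if F is the smallest
    face that carries G. It is unique since restrictions are compatible with
    intersections. *)
Lemma off_facets_carrier (G : {set W}) : G \in faces D' ->
  exists2 F, (F \in faces D) && (G \in off_facets T F F) &
    forall E, (E \in faces D) && (G \in off_facets T E E) -> E = F.
Proof.
move=> GD'; have [F0 F0D GF0] := restriction_cover T GD'.
pose P F := (F \in faces D) && (G \in restriction T F).
have P0 : P F0 by rewrite /P F0D.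
(* A carrying face of least cardinality carries G in none of its facets. *)
case: (arg_minnP (fun F : {set V} => #|F|) P0) => F /andP[FD GF] Fmin.
have offF : G \in off_facets T F F.
  rewrite in_off_facets GF; apply/forall_inP => a aF; apply/negP => Ga.
  have := Fmin (F :\ a); rewrite /P Ga (face_closed FD (subD1set _ _)) => /(_ isT).
  by rewrite [in X in (X <= _)%N -> _](cardsD1 a F) aF ltnn.
have sub E E' : E \in faces D -> E' \in faces D ->
    G \in off_facets T E E -> G \in restriction T E' -> E \subset E'.
  move=> ED E'D; rewrite in_off_facets => /andP[GE /forall_inP offE] GE'.
  apply/subsetP => a aE; apply: contrapT => /negP aE'.
  have := offE a aE; apply/negP; rewrite negbK.
  have EaD : E :\ a \in faces D by apply: face_closed ED (subD1set _ _).
  have : G \in restriction T (E :&: E') by rewrite -restrictionI // in_setI GE.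
  have -> : E :&: E' = (E :\ a) :&: E'.
    apply/setP => v; rewrite !inE; case: eqVneq => [->|//].
    by rewrite (negPf aE') !andbF.
  by rewrite -restrictionI // in_setI => /andP[].
exists F; first by rewrite FD.
move=> E /andP[ED offE]; apply/eqP; rewrite eqEsubset !sub //.
by move: offE; rewrite in_off_facets => /andP[].
Qed.

Lemma fnum_carrier (i : nat) :
  fnum D' i = (\sum_(F in faces D) fnum (off_facets T F F) i)%N.
Proof.
transitivity (\sum_(G in faces D' | #|G| == i)
    \sum_(F in faces D | G \in off_facets T F F) 1)%N.
  rewrite /fnum -sum1_card; apply: eq_big => [G|G]; rewrite inE // => /andP[GD' _].
  have [F FG uniq] := off_facets_carrier GD'.
  by rewrite (big_pred1 F) // => E /=; apply/idP/eqP => [/uniq|->].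
rewrite (exchange_big_dep (mem (faces D))) /=; last by move=> G F _ /andP[].
apply: eq_bigr => F FD; rewrite sum1_card; apply: eq_card => G.
rewrite in_set [LHS]unfold_in /= FD /=.
apply/idP/idP => [/andP[/andP[_ ->] ->] //|/andP[offG ->]].
rewrite offG !andbT; move: offG.
by rewrite in_off_facets => /andP[/restrictionP[]].
Qed.

Lemma rank_triangulation : rank D' = rank D.
Proof.
apply/eqP; rewrite eqn_leq; apply/andP; split.
  apply/bigmax_leqP => G GD'; have [F FD GF] := restriction_cover T GD'.
  by apply: (leq_trans (restriction_card_le FD GF)); apply: leq_bigmax_cond.
have [F FD <-] := rank_attained D.
have [G GF <-] := restriction_facet T FD; apply: leq_bigmax_cond.
by have [] := restrictionP _ _ _ GF.
Qed.

End Counting.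

(** * Uniform triangulations *)

Section Uniform.

Variable f : nat -> nat -> nat.

(** A triangulation of a simplex with j vertices has no face with more than j
    vertices; the values f i j with i > j are arbitrary and replaced by 0. *)
Definition ftri (i j : nat) : int := if (i <= j)%N then (f i j)%:Z else 0.

(** The number of faces with i vertices, off k facets, in a uniformly
    triangulated simplex with n vertices. *)
Definition relative_fnum (i n k : nat) : int := iter k diff (ftri i) (n - k)%N.

Definition relative_hpoly (n k : nat) : {poly int} :=
  \sum_(i < n.+1) relative_fnum i n k *: ('X^i * (1 - 'X) ^+ (n - i)).

Variables (d : option nat) (R : realType) (V W : finType).
Variables (D : simplicial_complex V) (D' : simplicial_complex W).
Variable T : triangulation R D D'.
Hypothesis unif : uniform d f T.

Lemma le_size_trans m n : (m <= n)%N -> le_size n d -> le_size m d.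
Proof. by case: d => //= e; apply: leq_trans. Qed.

Lemma fnum_off_facets (i : nat) (F K : {set V}) :
  F \in faces D -> le_size #|F| d -> K \subset F ->
  (fnum (off_facets T F K) i)%:Z = relative_fnum i #|F| #|K|.
Proof.
have [k] := ubnP #|K|; elim: k F K => // k IHk F K ltk FD Fd KF.
have [->|[a aK]] := set_0Vmem K.
  have -> : off_facets T F finset.set0 = restriction T F.
    apply/setP => G; rewrite in_off_facets; apply: andb_idr => _.
    by apply/forall_inP => a; rewrite inE.
  rewrite cards0 /relative_fnum subn0 /= /ftri; case: leqP => iF.
    by rewrite (unif iF).
  rewrite /fnum; apply/eqP; rewrite eqz_nat cards_eq0 -subset0.
  apply/subsetP => G; rewrite inE => /andP[GF /eqP Gi].
  by have := restriction_card_le FD GF; rewrite Gi leqNgt iF.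
have aF := subsetP KF a aK.
have cK := cardsD1 a K; have cF := cardsD1 a F; rewrite aK in cK; rewrite aF in cF.
have [offI offD] := off_facets_setD1 T FD KF aK.
have KF' : K :\ a \subset F :\ a by exact: setSD.
have := fnumID (off_facets T F (K :\ a)) (restriction T (F :\ a)) i.
rewrite offI offD => /(congr1 Posz); rewrite PoszD.
have ltk' : (#|K :\ a| < k)%N by rewrite -ltnS; move: ltk; rewrite cK.
rewrite (IHk F) ?(subset_trans (subD1set _ _)) //.
rewrite (IHk (F :\ a)) ?(face_closed FD (subD1set _ _)) //; last first.
  by apply: le_size_trans Fd; rewrite cF leq_addl.
move=> /eqP; rewrite addrC -subr_eq => /eqP <-.
rewrite /relative_fnum cK cF !add1n iterS /diff subSS subSn //.
exact: subset_leq_card.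
Qed.

Lemma relative_hpoly_ge0 (k j : nat) : le_size (rank D) d -> (k <= rank D)%N ->
  0 <= (relative_hpoly (rank D) k)`_j.
Proof.
move=> rd krank; have [F FD cF] := rank_attained D.
have [K KF cK] : exists2 K : {set V}, K \subset F & #|K| = k.
  rewrite -cF in krank; exists [set x in take k (enum F)].
    by apply/subsetP => x; rewrite inE => /mem_take; rewrite mem_enum.
  rewrite cardsE (card_uniqP (take_uniq _ (enum_uniq _))).
  by rewrite size_takel // -cardE.
suff -> : relative_hpoly (rank D) k = \sum_(G in off_facets T F K)
    'X^#|G| * (1 - 'X) ^+ (#|F| - #|G|) by exact: off_facets_hpoly.
rewrite (sum_by_card (n := rank D)
  (fun i => 'X^i * (1 - 'X) ^+ (#|F| - i) : {poly int})) => [|G].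
  rewrite /relative_hpoly; apply: eq_bigr => i _.
  have <- : (fnum (off_facets T F K) i)%:Z = relative_fnum i (rank D) k.
    by rewrite fnum_off_facets ?cF ?cK.
  by rewrite -natz scaler_nat cF.
by rewrite in_off_facets => /andP[GF _]; rewrite -cF (restriction_card_le FD GF).
Qed.

Lemma fnum_fine (i : nat) : le_size (rank D) d ->
  (fnum D' i)%:Z =
  \sum_(k < (rank D).+1) hnum D k * relative_fnum i (rank D) k.
Proof.
move=> rd; have leF F : F \in faces D -> (#|F| <= rank D)%N.
  by move=> FD; apply: leq_bigmax_cond.
rewrite (fnum_carrier T) -natz natr_sum.
rewrite (eq_bigr (fun F : {set V} => iter #|F| diff (ftri i) 0%N)); last first.
  move=> F FD; rewrite natz fnum_off_facets //; last exact: le_size_trans (leF F FD) rd.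
  by rewrite /relative_fnum subnn.
rewrite (sum_by_card (n := rank D) (fun m => iter m diff (ftri i) 0%N)) //.
under [RHS]eq_bigr do rewrite /hnum /hpoly coef_sum mulr_suml.
rewrite exchange_big; apply: eq_bigr => m _ /=.
rewrite -(sum_coef_bernstein (ftri i) (n := rank D)) ?leq_ord // -sumrMnl.
apply: eq_bigr => k _; rewrite coefZ -mulrA mulr_natl; congr (_ *+ _).
Qed.

End Uniform.

Theorem theorem1p1 (R : realType) (d : option nat) (f : nat -> nat -> nat) :
  exists p : nat -> nat -> nat -> nat,
  forall n : nat, le_size n d ->
  forall (V V' : finType) (D : simplicial_complex V)
    (D' : simplicial_complex V') (T : triangulation R D D'),
    rank D = n -> uniform d f T ->
  forall j : nat, (j <= n)%N ->
    hnum D' j = \sum_(k < n.+1) (p n k j)%:Z * hnum D k.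
Proof.
exists (fun n k j => absz (relative_hpoly f n k)`_j).
move=> n nd V W D D' T rD unif j _; rewrite -rD in nd *.
rewrite /hnum {1}/hpoly (rank_triangulation T) coef_sum.
under eq_bigr => i _ do rewrite coefZ natz (fnum_fine unif) // mulr_suml.
rewrite exchange_big; apply: eq_bigr => k _ /=.
rewrite gez0_abs; last by apply: (relative_hpoly_ge0 unif) => //; rewrite leq_ord.
rewrite coef_sum mulr_suml; apply: eq_bigr => i _.
by rewrite coefZ /hnum; ring.
Qed.
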